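(* Let $\mathcal C\subseteq 2^{[n]}$ and let $c_I>0$ ($I\in\mathcal C$) be positive real numbers. The positive Minkowski sum of Schubert matroid polytopes $$Q_{\mathcal C}:=\sum_{I\in\mathcal C}c_I\,Q(\theta_I)$$ is an MV polytope if and only if $\mathcal C$ is a weakly separated set in $2^{[n]}$.
   Context: Notation: $[n]=\{1,\dots,n\}$; $Xij$ means $X\cup\{i,j\}$, etc.; $x(S)=\sum_{i\in S}x_i$; $A-B$ is set difference. For $k$-subsets $L=\{l_1<\dots<l_k\}$ and $I=\{i_1<\dots<i_k\}$ of $[n]$, write $L\le_G I$ if $l_r\le i_r$ for all $r$. The Schubert matroid $\Omega_I$ is the matroid on $[n]$ whose bases are the $k$-subsets $L$ with $L\le_G I$, $k=|I|$; its rank function is $\theta_I(S)=\max\{|S\cap L| : L\text{ a basis of }\Omega_I\}$. A function $f:2^{[n]}\to\mathbb R$ is a DCTP (discrete concave tropical Plücker) function if it is submodular and satisfies $f(Xik)+f(Xj)=\max\{f(Xij)+f(Xk),\,f(Xjk)+f(Xi)\}$ for all $i<j<k$ in $[n]$ and $X\subseteq[n]\setminus\{i,j,k\}$. For a submodular $f$ with $f(\emptyset)=0$, $Q(f)=\{x\in\mathbb R^n : x(S)\le f(S)\ \forall S\subsetneq[n],\ x([n])=f([n])\}$. An MV polytope (of type A) is a polytope of the form $Q(f)$ with $f$ a DCTP function, $f(\emptyset)=0$. Weak separation: write $A\prec B$ if $a<b$ for all $a\in A,b\in B$ (vacuously true if $A$ or $B$ is empty). Sets $A,B\subseteq[n]$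 are weakly separated if at least one of the following holds: (i) $|A|\ge|B|$ and $B-A=B'\sqcup B''$ with $B'\prec A-B\prec B''$; (ii) $|B|\ge|A|$ and $A-B=A'\sqcup A''$ with $A'\prec B-A\prec A''$ (the parts may be empty). A collection $\mathcal C\subseteq2^{[n]}$ is a weakly separated set if any two of its elements are weakly separated. *)

(* Defs.v *)
From mathcomp Require Import all_boot all_order all_algebra.
From mathcomp Require Import classical_sets reals.

Set Implicit Arguments.
Unset Strict Implicit.
Unset Printing Implicit Defensive.

Import Order.TTheory GRing.Theory Num.Theory.

Local Open Scope ring_scope.

(* The ground set [n] is represented by 'I_n = {0, ..., n-1}: only the order
   of its elements matters, so the shift by one is harmless.  Subsets of [n]
   are finite sets {set 'I_n}; subsets of R^n are classical sets of row
   vectors. *)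

(* [enum L] lists the elements of L in increasing order, and [all2] is false on
   lists of different lengths, so this includes #|L| = #|I|. *)
Definition gale_le (n : nat) (L I : {set 'I_n}) : bool :=
  all2 (fun l i : 'I_n => (l <= i)%N) (enum L) (enum I).

Definition schubert_bases (n : nat) (I : {set 'I_n}) : {set {set 'I_n}} :=
  [set L | gale_le L I].

Definition schubert_rank (n : nat) (I S : {set 'I_n}) : nat :=
  (\max_(L in schubert_bases I) #|S :&: L|)%N.

Definition submodular (R : realType) (n : nat) (f : {set 'I_n} -> R) : Prop :=
  forall A B : {set 'I_n}, f (A :|: B) + f (A :&: B) <= f A + f B.

Definition DCTP (R : realType) (n : nat) (f : {set 'I_n} -> R) : Prop :=
  submodular f /\
  forall (i j k : 'I_n) (X : {set 'I_n}),
    (i < j)%N -> (j < k)%N -> i \notin X -> j \notin X -> k \notin X ->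
    f (X :|: [set i; k]) + f (X :|: [set j]) =
    Num.max (f (X :|: [set i; j]) + f (X :|: [set k]))
            (f (X :|: [set j; k]) + f (X :|: [set i])).

Definition base_polytope (R : realType) (n : nat) (f : {set 'I_n} -> R) :
    set 'rV[R]_n :=
  [set x : 'rV[R]_n |
    (forall S : {set 'I_n}, (S \proper [set: 'I_n])%SET ->
       \sum_(i in S) x 0 i <= f S) /\
    \sum_i x 0 i = f [set: 'I_n]%SET]%classic.

Definition MV_polytope (R : realType) (n : nat) (P : set 'rV[R]_n) : Prop :=
  exists f : {set 'I_n} -> R,
    [/\ DCTP f, f finset.set0 = 0 & P = base_polytope f].

Definition schubert_polytope (R : realType) (n : nat) (I : {set 'I_n}) :
    set 'rV[R]_n :=
  base_polytope (fun S => (schubert_rank I S)%:R).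

(* The Minkowski sum of the dilates c_I P_I over I in C; it is {0} for empty
   C. *)
Definition minkowski_sum (R : realType) (n : nat) (T : finType) (C : {set T})
    (c : T -> R) (P : T -> set 'rV[R]_n) : set 'rV[R]_n :=
  [set x | exists y : T -> 'rV[R]_n,
    (forall I, I \in C -> P I (y I)) /\ x = \sum_(I in C) c I *: y I]%classic.

Definition set_prec (n : nat) (A B : {set 'I_n}) : Prop :=
  forall a b : 'I_n, a \in A -> b \in B -> (a < b)%N.

(* [surrounds Y X]: Y is a disjoint union Y' U Y'' with Y' < X < Y''. *)
Definition surrounds (n : nat) (Y X : {set 'I_n}) : Prop :=
  exists Y' Y'' : {set 'I_n},
    [/\ Y = Y' :|: Y'', [disjoint Y' & Y''], set_prec Y' X & set_prec X Y''].

Definition weakly_separated (n : nat) (A B : {set 'I_n}) : Prop :=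
  ((#|B| <= #|A|)%N /\ surrounds (B :\: A) (A :\: B)) \/
  ((#|A| <= #|B|)%N /\ surrounds (A :\: B) (B :\: A)).

Definition weakly_separated_set (n : nat) (C : {set {set 'I_n}}) : Prop :=
  forall A B : {set 'I_n}, A \in C -> B \in C -> weakly_separated A B.

(* Main.v *)
Require Import Defs.
From mathcomp Require Import classical_sets reals.
From mathcomp Require Import all_boot all_order all_algebra zify ring lra.

(* The rank function of a Schubert matroid is
     theta_I(S) = min over gaps a of #(S below a) + #(I above a),
   so on the sets X :|: T with T included in {i < j < k} it depends only on
   four minima of a lattice path.  Each theta_I is therefore DCTP, and a
   positive combination is DCTP iff no triple makes one theta_U strictly prefer
   the first term of the tropical relation while another theta_V strictly
   prefers the second.  Such a triple exists iff the walk
   a |-> #(U above a) - #(V above a) crosses some level down, up and down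
   again, and this fails for both (U, V) and (V, U) iff U and V are weakly
   separated.  Finally Q(f) is determined by f and is additive in f, because
   it is the convex hull of its greedy vertices, which are linear in f. *)

Set Implicit Arguments.
Unset Strict Implicit.
Unset Printing Implicit Defensive.

(** * Counting below and above a gap, the Gale order, and the cut formula for the rank *)

Section Counting.
Variable n : nat.
Implicit Types (S I L X Y U V : {set 'I_n}) (x y i j k : 'I_n) (a b : nat).

Definition low S a := #|[set x in S | x < a]|.
Definition up S a := #|[set x in S | a <= x]|.

Lemma low_up S a : low S a + up S a = #|S|.
Proof.
rewrite /low /up -(cardsID [set x : 'I_n | x < a] S); congr (_ + _); apply: eq_card => x;
  rewrite !inE; first by [].
by rewrite andbC leqNgt.
Qed.

Lemma low0 S : low S 0 = 0.
Proof. by apply/eqP; rewrite cards_eq0; apply/eqP/setP => x; rewrite !inE ltn0 andbF. Qed.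

Lemma up0 S : up S 0 = #|S|.
Proof. by rewrite -(low_up S 0) low0. Qed.

Lemma low_n S : low S n = #|S|.
Proof. by apply: eq_card => x; rewrite !inE ltn_ord andbT. Qed.

Lemma up_n S : up S n = 0.
Proof. by have := low_up S n; rewrite low_n; lia. Qed.

Lemma low_set0 a : low set0 a = 0.
Proof. by apply/eqP; rewrite cards_eq0; apply/eqP/setP => x; rewrite !inE. Qed.

Lemma leq_low S : {homo low S : a b / a <= b}.
Proof.
move=> a b ab; apply/subset_leq_card/subsetP => x; rewrite !inE => /andP[-> /=].
by move/leq_trans; apply.
Qed.

Lemma lowS S x : low S x.+1 = low S x + (x \in S).
Proof.
rewrite /low (cardsD1 x) !inE ltnSn andbT addnC; congr (_ + _).
apply: eq_card => y; rewrite !inE ltnS -(inj_eq val_inj) /=.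
by case: (y \in S); rewrite ?andbF //= ltn_neqAle.
Qed.

Lemma upS S x : up S x = up S x.+1 + (x \in S).
Proof.
by have := low_up S x; have := low_up S x.+1; rewrite lowS; case: (x \in S); lia.
Qed.

Lemma leq_up S a b : a <= b -> up S b <= up S a.
Proof. by move=> /(leq_low S); have := low_up S a; have := low_up S b; lia. Qed.

(** This compares the numbers of elements in the interval from [a] to [b]; moving terms across
    avoids truncated subtraction. *)
Lemma low_incr_le X Y a b : a <= b <= n ->
  (forall x, a <= x < b -> x \in X -> x \in Y) ->
  low X b + low Y a <= low Y b + low X a.
Proof.
elim: b => [|b IHb] /andP[ab bn] XY.
  by rewrite (_ : a = 0) 1?addnC //; lia.
have [-> |ab'] := eqVneq a b.+1; first by rewrite addnC.
have {}IHb : low X b + low Y a <= low Y b + low X a.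
  by apply: IHb => [|x xab]; [lia | apply: XY; lia].
have : (Ordinal bn \in X) <= (Ordinal bn \in Y).
  by have := XY (Ordinal bn); case: (_ \in X) => // -> //=; lia.
by rewrite (lowS X (Ordinal bn)) (lowS Y (Ordinal bn)) /=;
  case: (_ \in X); case: (_ \in Y); lia.
Qed.

Lemma low_incr_eq X Y a b : a <= b <= n ->
  (forall x, a <= x < b -> (x \in X) = (x \in Y)) ->
  low X b + low Y a = low Y b + low X a.
Proof.
move=> abn XY; apply/eqP; rewrite eqn_leq; apply/andP; split.
  by apply: low_incr_le => // x /XY ->.
by rewrite addnC [leqRHS]addnC addnC [leqRHS]addnC low_incr_le // => x /XY ->.
Qed.

Lemma lowU1 x Y a : x \notin Y -> low (x |: Y) a = low Y a + (x < a).
Proof.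
move=> xY; rewrite /low; case: (ltnP x a) => xa; last first.
  rewrite addn0; apply: eq_card => y; rewrite !inE.
  by case: eqP => //= ->; rewrite ltnNge xa (negPf xY).
rewrite addn1 -[RHS]add1n (cardsD1 x) !inE eqxx xa; congr (_ + _).
apply: eq_card => y; rewrite !inE.
by case: eqP => //= ->; rewrite (negPf xY).
Qed.

Lemma lowUI X Y a : low (X :|: Y) a + low (X :&: Y) a = low X a + low Y a.
Proof.
rewrite -[RHS]cardsUI /low; congr (_ + _); apply: eq_card => x; rewrite !inE;
  by case: (x < a); rewrite ?andbT ?andbF.
Qed.

Lemma up_enum S a : up S a = count (fun l : 'I_n => a <= l) (enum S).
Proof.
rewrite /up cardE -size_filter; congr size.
by rewrite /enum_mem -filter_predI; apply: eq_filter => x; rewrite /= !inE andbC.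
Qed.

Lemma sorted_enum S : sorted (fun x y : 'I_n => x < y) (enum S).
Proof.
rewrite /enum_mem; apply: sorted_filter; first by move=> x y z; apply: ltn_trans.
have := iota_ltn_sorted 0 n; rewrite -val_enum_ord sorted_map.
by rewrite enumT.
Qed.

Lemma all2_count (s t : seq 'I_n) a : all2 (fun l i : 'I_n => l <= i) s t ->
  count (fun l : 'I_n => a <= l) s <= count (fun l : 'I_n => a <= l) t.
Proof.
elim: s t => [|l s IHs] [|i t] //= /andP[li /IHs]; lia.
Qed.

(** Taking [a] to be the head of [s] forces every entry of [t] to be at least that head. The count
    condition then passes to the tails: up to the head of [t] the whole tail of [t] counts, and
    beyond it neither head does. *)
Lemma count_all2 (s t : seq 'I_n) :
  sorted (fun x y : 'I_n => x < y) s -> sorted (fun x y : 'I_n => x < y) t ->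
  size s = size t ->
  (forall a, count (fun l : 'I_n => a <= l) s <= count (fun l : 'I_n => a <= l) t) ->
  all2 (fun l i : 'I_n => l <= i) s t.
Proof.
have tr : transitive (fun x y : 'I_n => x < y) by move=> x y z; apply: ltn_trans.
elim: s t => [|l s IHs] [|i t] //=.
rewrite !path_sortedE // => /andP[/allP ls ss] /andP[/allP it st] [sz] ct.
have ge_all (r : seq 'I_n) x a : {in r, forall y : 'I_n, x < y} -> a <= x ->
    count (fun l : 'I_n => a <= l) r = size r.
  by move=> xr ax; apply/eqP; rewrite -all_count; apply/allP => y /xr /=; lia.
have li : l <= i.
  have := ct l; rewrite (ge_all s l l ls) // leqnn.
  by have := count_size (fun m : 'I_n => l <= m) t; lia.
rewrite li /=; apply: IHs => // a; have := ct a.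
have := count_size (fun m : 'I_n => a <= m) s.
case: (leqP a i) => ai; first by rewrite (ge_all t i a it) // sz.
by have -> : (a <= l) = false by lia.
Qed.

Lemma gale_leE L I :
  gale_le L I <-> #|L| = #|I| /\ forall a, up L a <= up I a.
Proof.
split=> [LI | [LI ct]].
  split=> [|a]; last by rewrite !up_enum; apply: all2_count.
  by rewrite !cardE; move: LI; rewrite /gale_le all2E => /andP[/eqP].
apply: count_all2; rewrite ?sorted_enum -?cardE // => a.
by rewrite -!up_enum.
Qed.

Lemma upU1 x Y a : x \notin Y -> up (x |: Y) a = up Y a + (a <= x).
Proof.
move=> xY; have := low_up (x |: Y) a; have := low_up Y a.
by rewrite cardsU1 xY lowU1 //; lia.
Qed.

(** Below [a] a base meets [S] in at most [low S a] elements, and from [a] on the Gale order leaves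
    it at most [up I a] elements. *)
Lemma rank_le_cut I S a : schubert_rank I S <= low S a + up I a.
Proof.
apply/bigmax_leqP => L; rewrite inE => /gale_leE[_ /(_ a) ct].
apply: leq_trans (leq_add (leqnn _) ct).
rewrite -(low_up (S :&: L) a) leq_add //; apply/subset_leq_card/subsetP => x;
  by rewrite !inE => /andP[/andP[xS xL] ->]; rewrite ?xS ?xL.
Qed.

(* A base meeting S in the most elements admits no improving exchange of
   l in L - S for s in S - L, so a gap where L is as large as possible
   separates L - S from S - L; that gap attains the minimum. *)
Lemma rank_eq_cut I S :
  exists2 a, a <= n & schubert_rank I S = low S a + up I a.
Proof.
have II : I \in schubert_bases I by rewrite inE; apply/gale_leE.
have [L LI rkE] := @eq_bigmax_cond _ (mem (schubert_bases I)) (fun L => #|S :&: L|)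
  ltac:(by apply/card_gt0P; exists I).
rewrite -/(schubert_rank I S) in rkE.
move: (LI); rewrite inE => /gale_leE[cLI ctLI].
suff [a an [upa sep1 sep2]] : exists2 a, a <= n &
    [/\ up L a = up I a, forall s, s \in S -> s \notin L -> a <= s &
        forall l, l \in L -> l \notin S -> l < a].
  exists a => //; apply/eqP; rewrite eqn_leq rank_le_cut rkE -upa.
  rewrite -(low_up (S :&: L) a); apply: leq_add; apply/subset_leq_card/subsetP => x.
    rewrite !inE => /andP[xS xa]; rewrite xS xa andbT /=.
    by apply: contraLR xa => /(sep1 _ xS); rewrite -leqNgt.
  rewrite !inE => /andP[xL xa]; rewrite xL xa !andbT.
  by apply: contraLR xa => /(sep2 _ xL); rewrite -ltnNge.
have exch s l : s \in S -> s \notin L -> l \in L -> l \notin S ->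
    exists2 a, l < a <= s & up L a = up I a.
  move=> sS sL lL lS.
  case: (boolP [exists a : 'I_n.+1, (l < a <= s) && (up L a == up I a)]).
    by case/existsP => a /andP[las /eqP upa]; exists a.
  move/existsPn => noa.
  have sl : s \notin L :\ l by rewrite !inE (negPf sL) andbF.
  have upL b : up L b = up (L :\ l) b + (b <= l).
    by rewrite -upU1 ?setD1K // !inE eqxx.
  (* Replacing [l] by [s] raises the upper count only at gaps [b] with [l < b <= s], and there [noa]
     leaves room for one more. *)
  have LI' : s |: L :\ l \in schubert_bases I.
    rewrite inE; apply/gale_leE; split.
      by rewrite cardsU1 sl -cLI (cardsD1 l L) lL.
    move=> b; rewrite upU1 //; have := ctLI b; have := upL b.
    case: (ltnP n b) => bn; first by have : s < n by []; lia.
    by have /= := noa (Ordinal (bn : b < n.+1)); lia.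
  have := @leq_bigmax_cond _ (mem (schubert_bases I)) (fun L => #|S :&: L|) _ LI'.
  rewrite -/(schubert_rank I S) rkE.
  suff -> : S :&: (s |: L :\ l) = s |: (S :&: L).
    by rewrite cardsU1 !inE (negPf sL) andbF ltnn.
  apply/setP => x; rewrite !inE; have [->|_] /= := eqVneq x s; first by rewrite sS.
  by have [->|] := eqVneq x l; rewrite ?(negPf lS).
have [SL0|/set0Pn[s0]] := eqVneq (S :\: L) set0.
  exists n => //; split=> [|s sS sL|//]; first by rewrite !up_n.
  by have := in_set0 s; rewrite -SL0 !inE sS sL.
have [LS0 _|/set0Pn[l0]] := eqVneq (L :\: S) set0.
  exists 0 => //; split=> [|//|l lL lS]; first by rewrite !up0.
  by have := in_set0 l; rewrite -LS0 !inE lL lS.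
move=> l0P s0P.
(* For the least [s] in [S - L] and the greatest [l] in [L - S], a gap between [l] and [s] separates
   the two differences entirely. *)
case: (@arg_minnP _ s0 (fun x => x \in S :\: L) val s0P) => s; rewrite !inE => /andP[sL sS] smin.
case: (@arg_maxnP _ l0 (fun x => x \in L :\: S) val l0P) => l; rewrite !inE => /andP[lS lL] lmax.
have [a las upa] := exch s l sS sL lL lS.
exists a; first by have : s < n by []; lia.
split=> // [t tS tL|t tL tS].
  by have := smin t; rewrite !inE tS tL => /(_ isT) /=; lia.
by have := lmax t; rewrite !inE tS tL => /(_ isT) /=; lia.
Qed.

Lemma rank_set0 I : schubert_rank I set0 = 0.
Proof. by have := rank_le_cut I set0 n; rewrite low_set0 up_n; lia. Qed.

(** Let [a <= b] be optimal gaps for the two sets. Cut the union at [a] and the intersection at [b]: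
    from [a] to [b] the intersection gains no more elements than either set. *)
Lemma rank_submod I X Y :
  schubert_rank I (X :|: Y) + schubert_rank I (X :&: Y) <=
  schubert_rank I X + schubert_rank I Y.
Proof.
have [a an ->] := rank_eq_cut I X; have [b bn ->] := rank_eq_cut I Y.
wlog ab : X Y a b an bn / a <= b => [IH|].
  case/orP: (leq_total a b) => [/IH|]; first exact.
  by move=> /IH; rewrite setUC setIC => /(_ Y X bn an); lia.
have := rank_le_cut I (X :|: Y) a; have := rank_le_cut I (X :&: Y) b.
have := lowUI X Y a.
have := @low_incr_le (X :&: Y) Y a b ltac:(lia) (fun x _ => subsetP (subsetIr X Y) x); lia.
Qed.

End Counting.

(** * The tropical relation for one Schubert matroid *)

Section Triples.
Variable n : nat.
Implicit Types (S I L X Y U V : {set 'I_n}) (x y i j k : 'I_n) (a b : nat).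

Definition is_min (g : nat -> nat) l u m :=
  (exists2 a, l <= a < u & g a = m) /\ forall a, l <= a < u -> m <= g a.

Lemma is_min_exists (g : nat -> nat) l u : l < u -> exists m, is_min g l u m.
Proof.
elim: u => // u IHu; rewrite ltnS leq_eqVlt => /predU1P[-> | /IHu[m [[a la gm] mmin]]].
  exists (g u); split; first by exists u; rewrite ?leqnn ?ltnSn.
  by move=> a au; rewrite (_ : a = u) //; lia.
exists (minn m (g u)); split.
  case: (leqP m (g u)) => mu; first by exists a => //; lia.
  by exists u => //; lia.
move=> b lb; rewrite geq_min; have [->|bu] := eqVneq b u; first by rewrite leqnn orbT.
by rewrite mmin //; lia.
Qed.

(** The parts of the tropical relation: [rankA] and [rankB] are the first and second terms of the
    maximum, and [rankP] is the side equated with it. *)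
Definition rankA I X i j k :=
  schubert_rank I (X :|: [set i; j]) + schubert_rank I (X :|: [set k]).
Definition rankB I X i j k :=
  schubert_rank I (X :|: [set j; k]) + schubert_rank I (X :|: [set i]).
Definition rankP I X i j k :=
  schubert_rank I (X :|: [set i; k]) + schubert_rank I (X :|: [set j]).

(* The four minima of the cut function over the gaps left of i, between i and
   j, between j and k, and right of k determine the rank of X :|: T for every
   T included in {i, j, k}. *)
Lemma triple_ranks I X i j k (g := fun a => low X a + up I a) :
  i < j -> j < k -> i \notin X -> j \notin X -> k \notin X ->
  exists m0 m1 m2 m3,
  [/\ is_min g 0 i.+1 m0, is_min g i.+1 j.+1 m1, is_min g j.+1 k.+1 m2 &
      is_min g k.+1 n.+1 m3] /\
  [/\ rankA I X i j k = minn (minn m0 (m1 + 1)) (minn (m2 + 2) (m3 + 2)) +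
                        minn (minn m0 m1) (minn m2 (m3 + 1)),
      rankB I X i j k = minn (minn m0 m1) (minn (m2 + 1) (m3 + 2)) +
                        minn (minn m0 (m1 + 1)) (minn (m2 + 1) (m3 + 1)) &
      rankP I X i j k = minn (minn m0 (m1 + 1)) (minn (m2 + 1) (m3 + 2)) +
                        minn (minn m0 m1) (minn (m2 + 1) (m3 + 1))].
Proof.
move=> ij jk iX jX kX; have kn := ltn_ord k.
have [m0 M0] := is_min_exists g (ltn0Sn i).
have [m1 M1] := @is_min_exists g i.+1 j.+1 ij.
have [m2 M2] := @is_min_exists g j.+1 k.+1 jk.
have [m3 M3] := @is_min_exists g k.+1 n.+1 kn.
exists m0, m1, m2, m3; split=> //.
(* The bits tell which of [i], [j], [k] are added to [X]; each minimum is shifted by the number of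
   added points to its left. *)
have rk Y (bi bj bk : bool) :
    (forall a, low Y a = low X a + bi * (i < a) + bj * (j < a) + bk * (k < a)) ->
    schubert_rank I Y = minn (minn m0 (m1 + bi)) (minn (m2 + (bi + bj)) (m3 + (bi + bj + bk))).
  move=> lowY.
  have {}lowY a : low Y a + up I a = g a + (bi * (i < a) + bj * (j < a) + bk * (k < a)).
    by rewrite lowY /g; lia.
  have le a : schubert_rank I Y <= g a + (bi * (i < a) + bj * (j < a) + bk * (k < a)).
    by rewrite -lowY; apply: rank_le_cut.
  apply/eqP; rewrite eqn_leq; apply/andP; split.
    rewrite !leq_min.
    case: M0 M1 M2 M3 => [[a0 a0P <-] _] [[a1 a1P <-] _] [[a2 a2P <-] _] [[a3 a3P <-] _].
    by have := le a0; have := le a1; have := le a2; have := le a3; lia.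
  have [a an ->] := rank_eq_cut I Y; rewrite lowY.
  case: (leqP a i) => ai; first by have := M0.2 a; lia.
  case: (leqP a j) => aj; first by have := M1.2 a; lia.
  case: (leqP a k) => ak; first by have := M2.2 a; lia.
  by have := M3.2 a; lia.
have low1 x a : x \notin X -> low (X :|: [set x]) a = low X a + (x < a).
  by move=> xX; rewrite setUC lowU1.
have low2 x y a : x < y -> x \notin X -> y \notin X ->
    low (X :|: [set x; y]) a = low X a + (x < a) + (y < a).
  move=> xy xX yX; rewrite setUA (setUC _ [set y]) lowU1 ?low1 //.
  by rewrite !inE (negPf yX) -(inj_eq val_inj) /= gtn_eqF.
rewrite /rankA /rankB /rankP.
rewrite (rk _ true true false); last by move=> a; rewrite low2 //; lia.
rewrite (rk _ false false true); last by move=> a; rewrite low1 //; lia.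
rewrite (rk _ false true true); last by move=> a; rewrite low2 //; lia.
rewrite (rk _ true false false); last by move=> a; rewrite low1 //; lia.
rewrite (rk _ true false true); last by move=> a; rewrite low2 //; lia.
rewrite (rk _ false true false); last by move=> a; rewrite low1 //; lia.
by rewrite /= !addn0 !add0n.
Qed.

(** In terms of the four minima this is an identity valid for all natural numbers [m0], [m1], [m2],
    [m3]. *)
Lemma rankP_max I X i j k :
  i < j -> j < k -> i \notin X -> j \notin X -> k \notin X ->
  rankP I X i j k = maxn (rankA I X i j k) (rankB I X i j k).
Proof.
move=> ij jk iX jX kX.
have [m0 [m1 [m2 [m3 [_ [-> -> ->]]]]]] := triple_ranks I ij jk iX jX kX.
lia.
Qed.

(** For the four minima the strict inequality means [m0 = m2 + 1], [m1 > m2] and [m3 >= m2]; the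
    witness [m] is [m2]. *)
Lemma rankA_ltB I X i j k (g := fun a => low X a + up I a) :
  i < j -> j < k -> i \notin X -> j \notin X -> k \notin X ->
  (rankA I X i j k < rankB I X i j k <->
   exists m, [/\ is_min g 0 i.+1 m.+1, forall a, i < a <= j -> m < g a,
     is_min g j.+1 k.+1 m & forall a, k < a <= n -> m <= g a]).
Proof.
move=> ij jk iX jX kX; have kn := ltn_ord k.
have := triple_ranks I ij jk iX jX kX; rewrite -/g.
move=> [m0 [m1 [m2 [m3 [[M0 M1 M2 M3] [-> -> _]]]]]]; clearbody g.
split=> [AB | [m [[[a0 a0P g0] G0] G1 [[a2 a2P g2] G2] G3]]].
  have [m0E m1E m3E] : [/\ m0 = m2.+1, m2 < m1 & m2 <= m3] by split; lia.
  exists m2; split=> // [|a aP|a aP]; first by rewrite -m0E.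
    by apply: leq_trans (M1.2 a _); lia.
  by apply: leq_trans (M3.2 a _); lia.
case: M0 M1 M2 M3 => [[b0 b0P h0] H0] [[b1 b1P h1] H1] [[b2 b2P h2] H2] [[b3 b3P h3] H3].
have := H0 a0 a0P; have := G0 b0 b0P; have := H2 a2 a2P; have := G2 b2 b2P.
have := G1 b1; have := G3 b3; lia.
Qed.

(** Here the condition is [m1 = m3 + 1], [m0 > m3 + 1] and [m2 > m3]; the witness [m] is [m3]. *)
Lemma rankB_ltA I X i j k (g := fun a => low X a + up I a) :
  i < j -> j < k -> i \notin X -> j \notin X -> k \notin X ->
  (rankB I X i j k < rankA I X i j k <->
   exists m, [/\ forall a, a <= i -> m.+1 < g a, is_min g i.+1 j.+1 m.+1,
     forall a, j < a <= k -> m < g a & is_min g k.+1 n.+1 m]).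
Proof.
move=> ij jk iX jX kX; have kn := ltn_ord k.
have := triple_ranks I ij jk iX jX kX; rewrite -/g.
move=> [m0 [m1 [m2 [m3 [[M0 M1 M2 M3] [-> -> _]]]]]]; clearbody g.
split=> [AB | [m [G0 [[a1 a1P g1] G1] G2 [[a3 a3P g3] G3]]]].
  have [m0E m1E m2E] : [/\ m3.+1 < m0, m1 = m3.+1 & m3 < m2] by split; lia.
  exists m3; split=> // [a aP||a aP]; first by apply: leq_trans (M0.2 a _); lia.
    by rewrite -m1E.
  by apply: leq_trans (M2.2 a _); lia.
case: M0 M1 M2 M3 => [[b0 b0P h0] H0] [[b1 b1P h1] H1] [[b2 b2P h2] H2] [[b3 b3P h3] H3].
have := H1 a1 a1P; have := G1 b1 b1P; have := H3 a3 a3P; have := G3 b3 b3P.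
have := G0 b0; have := G2 b2; lia.
Qed.

End Triples.

(** * Opposite strict preferences and level crossings of the walk *)

Section Crossing.
Variable n : nat.
Implicit Types (S I L X Y U V : {set 'I_n}) (x y i j k : 'I_n) (a b s t : nat).

Lemma first_change (P : pred nat) a b : a <= b -> P a -> ~~ P b ->
  exists c, [/\ a <= c < b, forall z : nat, a <= z <= c -> P z & ~~ P c.+1].
Proof.
move=> ab Pa Pb.
have ex : exists d, (a <= d) && ~~ P d by exists b; rewrite ab.
case: (ex_minnP ex) => -[|d] /andP[ad Pd] dmin.
  by move: ad Pd; rewrite leqn0 => /eqP <-; rewrite Pa.
have db : d < b by apply: dmin; rewrite ab.
have ad' : a <= d.
  by move: ad; rewrite leq_eqVlt => /predU1P[aE|//]; rewrite -aE Pa in Pd.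
exists d; split=> //; first by rewrite ad'.
move=> y /andP[ay yd]; apply: contraLR yd => Py.
by rewrite -ltnNge; apply: dmin; rewrite ay.
Qed.

(* With w a := up U a - up V a, the inequality says that w a > t - s. *)
Definition above U V s t a := up V a + t < up U a + s.

(** The level is an arbitrary integer, possibly negative, hence given as a difference of two
    naturals. *)
Definition crosses U V := exists s t, exists x0 x1 x2 x3 : nat,
  [/\ [/\ x0 < x1, x1 < x2, x2 < x3 & x3 <= n],
      above U V s t x0, ~~ above U V s t x1, above U V s t x2 & ~~ above U V s t x3].

(** Negating a strict inequality of integers costs one, hence [t.+1]. Exchanging [U] and [V] turns
    upward crossings into downward ones. *)
Lemma aboveN U V s t a : above V U t.+1 s a = ~~ above U V s t a.
Proof. by rewrite /above addnS ltnS -leqNgt. Qed.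

(** The walk moves by at most one per step, so it leaves from exactly one above the level, at an
    element of [U] outside [V]. *)
Lemma above_step U V s t i : above U V s t i -> ~~ above U V s t i.+1 ->
  [/\ i \in U, i \notin V & up V i + t + 1 = up U i + s].
Proof.
rewrite /above upS (upS U i).
by case: (i \in U); case: (i \in V) => /=; split; lia.
Qed.

Lemma above_change U V s t a b : a <= b <= n ->
  above U V s t a -> ~~ above U V s t b ->
  exists i, [/\ a <= i < b, forall z : nat, a <= z <= i -> above U V s t z,
    ~~ above U V s t i.+1, i \in U :\: V & up V i + t + 1 = up U i + s].
Proof.
move=> /andP[ab bn] Pa Pb.
have [c [acb Pc Pc1]] := @first_change (above U V s t) a b ab Pa Pb.
have cn : c < n by lia.
have {}Pa : above U V s t c by apply: Pc; lia.
have [cU cV cE] := @above_step U V s t (Ordinal cn) Pa Pc1.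
by exists (Ordinal cn); rewrite inE cU cV.
Qed.

Lemma above_changeN U V s t a b : a <= b <= n ->
  ~~ above U V s t a -> above U V s t b ->
  exists i, [/\ a <= i < b, forall z : nat, a <= z <= i -> ~~ above U V s t z,
    above U V s t i.+1, i \in V :\: U & up U i + s = up V i + t].
Proof.
move=> ab Pa Pb.
have [||i [aib Pi Pi1 iV iE]] := @above_change V U t.+1 s a b ab.
- by rewrite aboveN.
- by rewrite aboveN negbK.
exists i; split=> // [y /Pi||]; [by rewrite aboveN|by move: Pi1; rewrite aboveN negbK|lia].
Qed.

(** The two cut functions share the term [low X a], so their difference is the walk. Where one
    attains its minimum the other is bounded below, which places the walk alternately above and not
    above [q - p]. *)
Lemma preferences_cross U V X i j k :
  i < j -> j < k -> i \notin X -> j \notin X -> k \notin X ->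
  rankB U X i j k < rankA U X i j k -> rankA V X i j k < rankB V X i j k ->
  crosses U V.
Proof.
move=> ij jk iX jX kX; have kn := ltn_ord k.
case/rankB_ltA=> // q [U0 [[b1 b1P Ub1] U1] U2 [[b3 b3P Ub3] U3]].
case/rankA_ltB=> // p [[[a0 a0P Va0] V0] V1 [[a2 a2P Va2] V2] V3].
exists p, q, a0, b1, a2, b3; rewrite /above.
have := U0 a0; have := U2 a2; have := V1 b1; have := V3 b3.
by split; [split| | | |]; lia.
Qed.

(** Each search starts right after the previous crossing, so the walk stays on one side of the level
    between the chosen points. *)
Lemma consecutive_crossings U V : crosses U V -> exists s t i j k,
  [/\ [/\ i < j, j < k, i \in U :\: V, j \in V :\: U & k \in U :\: V],
      forall z : nat, i < z <= j -> up U z + s <= up V z + t,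
      forall z : nat, j < z <= k -> up V z + t < up U z + s &
      [/\ up V i + t + 1 = up U i + s, up U j + s = up V j + t &
          up V k + t + 1 = up U k + s]].
Proof.
case=> s [t [x0 [x1 [x2 [x3 [[x01 x12 x23 x3n] P0 P1 P2 P3]]]]]].
have [|//|//|i [iP _ Pi iUV iE]] := @above_change U V s t x0 x1.
  by clear -x01 x12 x23 x3n; lia.
have [|//|//|j [jP Pij Pj jVU jE]] := @above_changeN U V s t i.+1 x2.
  by clear -x12 x23 x3n iP; lia.
have [|//|//|k [kP Pjk Pk kUV kE]] := @above_change U V s t j.+1 x3.
  by clear -x23 x3n jP; lia.
exists s, t, i, j, k; split=> // [|z zP].
  by clear -iUV jVU kUV jP kP; split=> //; lia.
by rewrite leqNgt; apply: Pij.
Qed.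

(* X copies U between i and j and V between j and k, so that both cut
   functions are as flat as the crossing allows, and it is empty before i and
   full after k, so that the outer minima are attained next to i and k. *)
Lemma cross_preferences U V : crosses U V -> exists X i j k,
  [/\ [/\ i < j, j < k, i \notin X, j \notin X & k \notin X],
      rankB U X i j k < rankA U X i j k & rankA V X i j k < rankB V X i j k].
Proof.
case/consecutive_crossings=> s [t [i [j [k]]]].
case=> -[ij jk /setDP[iU iV] /setDP[jV jU] /setDP[kU kV]] Pij Pjk [iE jE kE].
have kn := ltn_ord k.
pose X := [set x : 'I_n | [|| (i < x < j) && (x \in U), (j < x < k) && (x \in V) | k < x]].
have iX : i \notin X.
  by rewrite inE ltnn (_ : j < i = false) 1?(_ : k < i = false) //; clear -ij jk; lia.
have jX : j \notin X.
  by rewrite inE ltnn andbF (_ : k < j = false) //; clear -ij jk; lia.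
have kX : k \notin X.
  by rewrite inE ltnn andbF (_ : k < j = false) ?andbF //; clear -ij jk; lia.
have X0 a : a <= i.+1 -> low X a = 0.
  move=> ai; have := @low_incr_eq n X set0 0 a; rewrite !low0 low_set0 !addn0; apply.
    by clear -ai ij jk kn; lia.
  move=> x /andP[_ xa]; have {xa ai} xi := leq_trans xa ai.
  by rewrite !inE (_ : i < x = false) 1?(_ : j < x = false) 1?(_ : k < x = false) //;
    clear -xi ij jk; lia.
have X1 a : i < a <= j -> low X a + low U i.+1 = low U a.
  move=> ai; have := @low_incr_eq n X U i.+1 a; rewrite (X0 i.+1) // addn0; apply.
    by clear -ai ij jk kn; lia.
  move=> x xa; rewrite !inE (_ : i < x < j) 1?(_ : j < x = false) 1?(_ : k < x = false) ?orbF //;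
    clear -xa ai ij jk; lia.
have X2 a : j < a <= k -> low X a + low V j.+1 = low V a + low X j.+1.
  move=> ai; apply: low_incr_eq; first by clear -ai ij jk kn; lia.
  move=> x xa; rewrite !inE (_ : j < x < k) 1?(_ : x < j = false)
    1?(_ : k < x = false) ?andbF ?orbF //;
    clear -xa ai ij jk; lia.
have X3 S a : k < a <= n -> low S a + low X k.+1 <= low X a + low S k.+1.
  by move=> ka; apply: low_incr_le => // x /andP[kx _] _; rewrite !inE kx !orbT.
have := lowS X i; have := lowS X j; have := lowS X k.
have := lowS U i; have := lowS U j; have := lowS U k.
have := lowS V i; have := lowS V j; have := lowS V k.
rewrite iU jV kU (negPf iV) (negPf jU) (negPf kV).
rewrite (negPf iX) (negPf jX) (negPf kX) /= !addn0 !addn1.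
move=> lVk lVj lVi lUk lUj lUi lXk lXj lXi.
have cU a := low_up U a; have cV a := low_up V a.
clear iU jV kU iV jU kV.
have X0i := X0 _ (leqnn i.+1).
have X0i' := X0 _ (leqnSn i).
have ui := cU i. have ui1 := cU i.+1.
have uj := cU j. have uj1 := cU j.+1.
have uk := cU k. have uk1 := cU k.+1.
have vi := cV i. have vi1 := cV i.+1.
have vj := cV j. have vj1 := cV j.+1.
have vk := cV k. have vk1 := cV k.+1.
have X1j := X1 j; have X2k := X2 k.
exists X, i, j, k; split=> //.
  apply/rankB_ltA => //; clear iX jX kX.
  exists (low X k.+1 + up U k.+1); split.
  - move=> a ai; have X0a := X0 a (leqW ai).
    have := leq_up U ai; lia.
  - split; first by exists i.+1; lia.
    by move=> a ai; have := X1 a; have := cU a; lia.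
  - by move=> a ai; have := X2 a; have := Pjk a; have := cU a; have := cV a; lia.
  - split; first by exists k.+1; lia.
    by move=> a ai; have := X3 U a; have := cU a; lia.
apply/rankA_ltB => //; clear iX jX kX.
(* Between [j] and [k] the set [X] copies [V], so this cut function is constant there and [j.+1]
   already gives its minimum. *)
exists (low X j.+1 + up V j.+1); split.
- split; first by exists i; lia.
  by move=> a ai; have := X0 a; have := @leq_up _ V a i; lia.
- by move=> a ai; have := X1 a; have := Pij a; have := cV a; have := cU a; lia.
- split; first by exists j.+1; lia.
  by move=> a ai; have := X2 a; have := cV a; lia.
by move=> a ai; have := X3 V a; have := cV a; lia.
Qed.

End Crossing.

(** * Weak separation as absence of crossings *)

Section WeakSeparation.
Variable n : nat.
Implicit Types (I J U V X Y : {set 'I_n}) (x y z i j k : 'I_n).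

Definition alternates X Y := exists x y z,
  [/\ x < y, y < z, x \in X, y \in Y & z \in X].

(** Let [Y'] collect the elements of [Y] below all of [X]. Every other element of [Y] has a point of
    [X] before it, hence none after it unless there is an alternation. *)
Lemma surroundsP X Y : [disjoint X & Y] ->
  surrounds Y X \/ alternates X Y.
Proof.
move=> dXY.
case: (boolP [exists x : 'I_n, exists y : 'I_n, exists z : 'I_n,
  [&& x < y, y < z, x \in X, y \in Y & z \in X]]).
  case/existsP=> x /existsP[y /existsP[z /and5P[xy yz xX yY zX]]].
  by right; exists x, y, z.
move=> noalt; left.
exists [set y in Y | [forall x : 'I_n in X, y < x]], [set y in Y | ~~ [forall x : 'I_n in X, y < x]].
split.
- by apply/setP => y; rewrite !inE -andb_orr orbN andbT.
- by apply/pred0P => y /=; rewrite !inE; case: (y \in Y) => //=; rewrite andbN.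
- by move=> y x; rewrite inE => /andP[_ /forall_inP]; apply.
move=> z y zX; rewrite inE => /andP[yY /forall_inPn[x xX]]; rewrite -leqNgt => xy.
rewrite ltnNge; apply/negP => yz.
have neq w : w \in X -> w != y :> nat.
  by move=> wX; apply: contraTneq yY => /val_inj <-; rewrite (disjointFr dXY).
case/existsP: noalt; exists x; apply/existsP; exists y; apply/existsP; exists z.
by rewrite xX yY zX !ltn_neqAle neq // xy yz eq_sym neq.
Qed.

Lemma surrounds_alternates X Y : surrounds Y X -> ~ alternates X Y.
Proof.
case=> Y1 [Y2 [-> _ Y1X XY2]] [x [y [z [xy yz xX yY zX]]]].
case/setUP: yY => [/Y1X/(_ xX)|/(XY2 z y zX)]; lia.
Qed.

Lemma weakly_separated_sym U V : weakly_separated U V -> weakly_separated V U.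
Proof. by case; [right|left]. Qed.

Lemma disjoint_setD U V : [disjoint U :\: V & V :\: U].
Proof.
by apply/pred0P => x /=; rewrite !inE; case: (x \in U); case: (x \in V).
Qed.

Lemma weakly_separated_cross U V : weakly_separated U V -> ~ crosses U V.
Proof.
move=> ws [s [t [x0 [x1 [x2 [x3 [[x01 x12 x23 x3n] P0 P1 P2 P3]]]]]]].
have [|//|//|a [aP _ _ aA _]] := @above_change n U V s t x0 x1; first lia.
have [|//|//|b [bP _ _ bB _]] := @above_changeN n U V s t x1 x2; first lia.
have [|//|//|c [cP _ _ cA _]] := @above_change n U V s t x2 x3; first lia.
case: ws => -[UV sep]; apply: (surrounds_alternates sep).
  by exists a, b, c; split=> //; lia.
(* Here the walk starts at [#|U| - #|V| <= 0] and ends at 0, so there is one more upward crossing,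
   before [x0] or after [x3]; it yields an alternation beginning and ending in [V - U]. *)
have N0 : ~~ above U V s t 0 \/ above U V s t n.
  by rewrite /above !up0 !up_n; lia.
case: N0 => [P|P].
  have [|//|//|b' [b'P _ _ b'B _]] := @above_changeN n U V s t 0 x0; first lia.
  by exists b', a, b; split=> //; clear -aP bP b'P x12; lia.
have [|//|//|b' [b'P _ _ b'B _]] := @above_changeN n U V s t x3 n; first lia.
by exists b, c, b'; split=> //; clear -bP cP b'P x12; lia.
Qed.

(** The walk starts at [#|U| - #|V| >= 0], ends at 0, and steps down at [a], up at [b], down at [c].
    If it is nonnegative at [b], the gap [n] can end a crossing; otherwise the gap 0 can begin one.
    The level is 0 or the value of the walk at [b], [a.+1] or [c.+1]. What escapes is a walk from 0
    to 0 that is negative and later positive. *)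
Lemma alternates_cross U V : #|V| <= #|U| -> alternates (U :\: V) (V :\: U) ->
  crosses U V \/ #|U| = #|V| /\
    exists x y : nat, [/\ x < y, y < n, up U x < up V x & up V y < up U y].
Proof.
move=> VU [a [b [c [ab bc /setDP[aU aV] /setDP[bV bU] /setDP[cU cV]]]]].
have := (upS U a, upS V a); rewrite aU (negPf aV) => -[Ua Va].
have := (upS U b, upS V b); rewrite (negPf bU) bV => -[Ub Vb].
have := (upS U c, upS V c); rewrite cU (negPf cV) => -[Uc Vc].
have U0 := up0 U; have V0 := up0 V; have Un := up_n U; have Vn := up_n V.
have cn := ltn_ord c; rewrite /= !addn0 !addn1 in Ua Va Ub Vb Uc Vc.
have cross s t (x0 x1 x2 x3 : nat) : x0 < x1 -> x1 < x2 -> x2 < x3 -> x3 <= n ->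
    above U V s t x0 -> ~~ above U V s t x1 -> above U V s t x2 ->
    ~~ above U V s t x3 -> crosses U V.
  by move=> *; exists s, t, x0, x1, x2, x3.
rewrite /above in cross.
clear aU aV bU bV cU cV.
case: (leqP (up V b) (up U b)) => beta.
  case: (leqP (up U b.+1 + up V a.+1) (up V b.+1 + up U a.+1)) => ba.
    by left; apply: (cross (up V b) (up U b) a b b.+1 n); lia.
  case: (leqP (up V a.+1) (up U a.+1)) => alpha.
    by left; apply: (cross (up V a.+1) (up U a.+1) a a.+1 b.+1 n); lia.
  have [UV|UV] := eqVneq #|U| #|V|.
    by right; split=> //; exists a.+1, b.+1; split; lia.
  by left; apply: (cross 0 0 0 a.+1 b.+1 n); lia.
case: (leqP (up U c.+1 + up V b) (up V c.+1 + up U b)) => cb.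
  by left; apply: (cross (up V b) (up U b) 0 b b.+1 c.+1); lia.
case: (ltnP (up U c.+1 + #|V|) (up V c.+1 + #|U|)) => gamma.
  by left; apply: (cross (up V c.+1) (up U c.+1) 0 b c c.+1); lia.
have [UV|UV] := eqVneq #|U| #|V|.
  by right; split=> //; exists b, c; split; lia.
by left; apply: (cross 0 0 0 b c n); lia.
Qed.

Lemma not_cross_weakly_separated U V :
  ~ crosses U V -> ~ crosses V U -> weakly_separated U V.
Proof.
wlog VU : U V / #|V| <= #|U|.
  move=> IH nUV nVU; case/orP: (leq_total #|V| #|U|) => [/IH|/IH ws]; first exact.
  by apply: weakly_separated_sym; apply: ws.
move=> nUV nVU.
case: (surroundsP (disjoint_setD U V)) => [|alt]; first by left.
case: (alternates_cross VU alt) => [//|[UV [x [y [xy yn Ux Uy]]]]].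
case: (surroundsP (disjoint_setD V U)) => [|alt']; first by right; rewrite UV.
case: (@alternates_cross V U _ alt') => [|//|[_ [x' [y' [xy' yn' Vx Vy]]]]]; first by rewrite UV.
have U0 := up0 U; have V0 := up0 V; have Un := up_n U; have Vn := up_n V.
(* The walk is negative at [x] and later positive, and positive at [x'] and later negative.
   Whichever comes first, three alternating signs and the final value 0 give a crossing of level
   0. *)
exfalso; case: (ltngtP x x') => xx'.
- apply: nVU; exists 0, 0, x, x', y', n; rewrite /above; split; [split| | | |]; lia.
- apply: nUV; exists 0, 0, x', x, y, n; rewrite /above; split; [split| | | |]; lia.
by move: Ux Vx; rewrite xx'; lia.
Qed.

End WeakSeparation.

Import Order.TTheory GRing.Theory Num.Theory.
Local Open Scope ring_scope.

(** * Base polytopes, their greedy vertices, and Minkowski sums *)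

Section BasePolytope.
Variables (R : realType) (n : nat).
Implicit Types (f : {set 'I_n} -> R) (x y : 'rV[R]_n) (S A B : {set 'I_n}) (r : 'I_n -> nat).

Definition vsum x S := \sum_(i in S) x 0 i.

Lemma vsumUI x A B : vsum x (A :|: B) + vsum x (A :&: B) = vsum x A + vsum x B.
Proof.
have U : vsum x (A :|: B) = vsum x A + vsum x (B :\: A).
  by rewrite /vsum (big_setID A) /= (setIidPr (subsetUl A B)) setDUl setDv set0U.
have V : vsum x B = vsum x (A :&: B) + vsum x (B :\: A).
  by rewrite /vsum (big_setID A) /= setIC.
by rewrite U V; ring.
Qed.

Lemma base_polytopeP f x :
  base_polytope f x <->
  (forall S, vsum x S <= f S) /\ vsum x [set: 'I_n]%SET = f [set: 'I_n]%SET.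
Proof.
have -> : vsum x [set: 'I_n]%SET = \sum_i x 0 i by apply: eq_bigl => i; rewrite inE.
split=> -[xf xT]; split=> // S; last by move=> _; apply: xf.
have [->|ST] := eqVneq S [set: 'I_n]%SET; last by apply: xf; rewrite properT.
by rewrite -xT /vsum (eq_bigl predT) // => i; rewrite inE.
Qed.

Lemma base_polytope_convex f x y (t : R) : 0 <= t <= 1 ->
  base_polytope f x -> base_polytope f y ->
  base_polytope f (t *: x + (1 - t) *: y).
Proof.
move=> /andP[t0 t1] /base_polytopeP[xf xT] /base_polytopeP[yf yT].
have E S : vsum (t *: x + (1 - t) *: y) S = t * vsum x S + (1 - t) * vsum y S.
  by rewrite /vsum !mulr_sumr -big_split; apply: eq_bigr => i _; rewrite !mxE.
apply/base_polytopeP; split=> [S|]; last by rewrite E xT yT -mulrDl addrC subrK mul1r.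
have t1' : 0 <= 1 - t by rewrite subr_ge0.
by have := ler_wpM2l t0 (xf S); have := ler_wpM2l t1' (yf S); rewrite E; lra.
Qed.

(** Edmonds' greedy vector: the marginal values of [f] as elements are added in the order of [r]. An
    injective [r] encodes a linear order; its values need not be consecutive. *)
Definition greedy f r : 'rV[R]_n :=
  \row_i (f [set j | (r j <= r i)%N] - f [set j | (r j < r i)%N]).

Definition down_closed r S := forall i j, i \in S -> (r j <= r i)%N -> j \in S.

Lemma vsumD1 x S i : i \in S -> vsum x S = x 0 i + vsum x (S :\ i).
Proof. exact: big_setD1. Qed.

Lemma greedy_top_peel r S : injective r -> S != set0 -> exists2 m, m \in S &
  S \subset [set j | (r j <= r m)%N] /\ S :\ m \subset [set j | (r j < r m)%N].
Proof.
move=> rI /set0Pn[i0 i0S]; have [m mS mmax] := @arg_maxnP _ i0 (mem S) r i0S.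
exists m => //; split; apply/subsetP => j; rewrite !inE; first exact: mmax.
by move=> /andP[jm jS]; rewrite ltn_neqAle (inj_eq rI) jm; apply: mmax.
Qed.

(** Remove the last element [i] of [S]: by submodularity its marginal value over all its
    predecessors is at most that over [S :\ i]. *)
Lemma greedy_le f r S : submodular f -> f set0 = 0 -> injective r ->
  vsum (greedy f r) S <= f S.
Proof.
move=> fs f0 rI; have [m] := ubnP #|S|; elim: m S => // m IHm S cS.
have [->|S0] := eqVneq S set0; first by rewrite /vsum big_set0 f0.
have [i iS [Sle Slt]] := greedy_top_peel rI S0.
rewrite (vsumD1 _ iS) mxE.
have IH : vsum (greedy f r) (S :\ i) <= f (S :\ i).
  by apply: IHm; move: cS; rewrite (cardsD1 i S) iS.
have := fs S [set j | (r j < r i)%N].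
have -> : S :|: [set j | (r j < r i)%N] = [set j | (r j <= r i)%N].
  apply/setP => j; rewrite !inE (leq_eqVlt (r j) (r i)) (inj_eq rI).
  have [->|ji] /= := eqVneq j i; first by rewrite iS.
  by apply: orb_idl => jS; have := subsetP Slt j; rewrite !inE ji jS => ->.
have -> : S :&: [set j | (r j < r i)%N] = S :\ i.
  apply/setP => j; rewrite !inE andbC.
  have [->|ji] /= := eqVneq j i; first by rewrite ltnn.
  by apply: andb_idl => jS; have := subsetP Slt j; rewrite !inE ji jS => ->.
move: IH; lra.
Qed.

Lemma greedy_eq f r S : f set0 = 0 -> injective r -> down_closed r S ->
  vsum (greedy f r) S = f S.
Proof.
move=> f0 rI; have [m] := ubnP #|S|; elim: m S => // m IHm S cS dS.
have [->|S0] := eqVneq S set0; first by rewrite /vsum big_set0 f0.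
have [i iS [Sle Slt]] := greedy_top_peel rI S0.
have Sle_eq : [set j | (r j <= r i)%N] = S.
  apply/eqP; rewrite eqEsubset Sle andbT; apply/subsetP => j; rewrite inE.
  exact: dS.
have Slt_eq : [set j | (r j < r i)%N] = S :\ i.
  apply/eqP; rewrite eqEsubset Slt andbT; apply/subsetP => j; rewrite !inE => ji.
  by rewrite (dS i) ?(ltnW ji) // andbT; apply: contraTneq ji => ->; rewrite ltnn.
rewrite (vsumD1 _ iS) mxE Sle_eq Slt_eq IHm ?subrK //.
  by move: cS; rewrite (cardsD1 i S) iS.
move=> j k; rewrite -Slt_eq !inE => ji kj; exact: leq_ltn_trans kj ji.
Qed.

Lemma greedy_base f r : submodular f -> f set0 = 0 -> injective r ->
  base_polytope f (greedy f r).
Proof.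
move=> fs f0 rI; apply/base_polytopeP; split=> [S|]; first exact: greedy_le.
by apply: greedy_eq => // i j; rewrite !inE.
Qed.

Lemma base_polytope_attains f S : submodular f -> f set0 = 0 ->
  exists2 x, base_polytope f x & vsum x S = f S.
Proof.
(* Adding [n] outside [S] makes [S] an initial segment of the order. *)
move=> fs f0; pose r (i : 'I_n) := (i + n * (i \notin S))%N.
have rI : injective r.
  move=> i j; rewrite /r; case: (i \in S); case: (j \in S) => /= rij; apply: val_inj => /=;
    have := ltn_ord i; have := ltn_ord j; lia.
exists (greedy f r); first exact: greedy_base.
apply: greedy_eq => // i j iS; rewrite /r iS /=.
by case: (j \in S) => //=; have := ltn_ord i; lia.
Qed.

(** The value [f S] is recovered as the maximum of [vsum x S] over the polytope. *)
Lemma base_polytope_inj f g : submodular f -> f set0 = 0 ->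
  submodular g -> g set0 = 0 -> base_polytope f = base_polytope g -> f =1 g.
Proof.
move=> fs f0 gs g0 fg S; apply/le_anti/andP; split.
  have [x + <-] := base_polytope_attains S fs f0.
  by rewrite fg => /base_polytopeP[].
have [x + <-] := base_polytope_attains S gs g0.
by rewrite -fg => /base_polytopeP[].
Qed.

Definition tight f x := [set S | vsum x S == f S].

Lemma tightUI f x A B : submodular f -> base_polytope f x ->
  A \in tight f x -> B \in tight f x ->
  A :|: B \in tight f x /\ A :&: B \in tight f x.
Proof.
move=> fs /base_polytopeP[xf _]; rewrite !inE => /eqP xA /eqP xB.
have := vsumUI x A B; have := fs A B; have := xf (A :|: B); have := xf (A :&: B).
rewrite xA xB => h1 h2 h3 h4.
by split; apply/eqP; lra.
Qed.

Lemma vsum_shift x i j (t : R) S : i != j ->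
  vsum (x + t *: (delta_mx 0 i - delta_mx 0 j)) S =
  vsum x S + t * ((i \in S)%:R - (j \in S)%:R).
Proof.
move=> ij; rewrite /vsum.
have D k : \sum_(l in S) (delta_mx 0 k : 'rV[R]_n) 0 l = (k \in S)%:R.
  case: (boolP (k \in S)) => kS.
    rewrite (big_setD1 k) //= mxE !eqxx big1 ?addr0 // => l.
    by rewrite !inE mxE eqxx => /andP[/negPf ->].
  by rewrite big1 // => l lS; rewrite mxE eqxx /=; case: eqP => // lk; rewrite -lk lS in kS.
rewrite -!D -sumrB mulr_sumr -big_split; apply: eq_bigr => l _.
by rewrite !mxE.
Qed.

(** Moving weight from [j] to [i] preserves every tight set and uses up slack only in sets
    containing [i] but not [j]; [t] is the least such slack, so the move makes a new set tight. *)
Lemma tight_shift f x i j : i != j -> base_polytope f x ->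
  (forall S, S \in tight f x -> (i \in S) = (j \in S)) ->
  exists2 t, 0 < t & let y := x + t *: (delta_mx 0 i - delta_mx 0 j) in
    base_polytope f y /\ tight f x \proper tight f y.
Proof.
move=> ij /base_polytopeP[xf xT] tij.
pose P S := (i \in S) && (j \notin S).
have P0 : P [set i] by rewrite /P !inE eqxx eq_sym.
case: (arg_minP (fun S => f S - vsum x S) P0) => S0 PS0 S0min.
exists (f S0 - vsum x S0).
  rewrite subr_gt0 lt_neqAle xf andbT; apply/negP => S0t.
  by have := tij S0; rewrite inE S0t => /(_ isT); case/andP: PS0 => -> /negPf ->.
move=> y; have yE S : vsum y S = _ := vsum_shift x (f S0 - vsum x S0) S ij.
have S0y : S0 \in tight f y.
  by rewrite inE yE; case/andP: PS0 => -> /negPf ->; rewrite subr0 mulr1 addrC subrK.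
split.
  apply/base_polytopeP; split=> [S|]; last by rewrite yE !inE subrr mulr0 addr0.
  have t0 : 0 <= f S0 - vsum x S0 by rewrite subr_ge0.
  rewrite yE; have := xf S; have := S0min S; rewrite /P.
  case: (i \in S); case: (j \in S) => /=;
    rewrite ?subrr ?subr0 ?sub0r ?mulr0 ?mulr1 ?mulrN1 => h1 h2.
  - by rewrite addr0.
  - by have := h1 isT; lra.
  - by lra.
  - by rewrite addr0.
apply/properP; split; last first.
  exists S0 => //; apply/negP => /tij.
  by case/andP: PS0 => -> /negPf ->.
apply/subsetP => S St; rewrite inE yE (tij S St) subrr mulr0 addr0.
by move: St; rewrite inE.
Qed.

(* When tight sets separate all points, the smallest tight sets around the
   points order the ground set, and x is the greedy vector of that order. *)
Lemma tight_separated_greedy f x : submodular f -> f set0 = 0 ->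
  base_polytope f x ->
  (forall i j, i != j -> exists2 S, S \in tight f x & (i \in S) != (j \in S)) ->
  exists2 r, injective r & x = greedy f r.
Proof.
move=> fs f0 xf sep.
have T0 : set0 \in tight f x by rewrite inE /vsum big_set0 f0.
have TT : [set: 'I_n]%SET \in tight f x.
  by rewrite inE; apply/eqP; case/base_polytopeP: xf.
pose D i := \bigcap_(S in tight f x | i \in S) S.
have Dt i : D i \in tight f x.
  rewrite /D; elim/big_ind: _ => [//|A B At Bt|S /andP[]//].
  by have [] := tightUI fs xf At Bt.
have iD i : i \in D i by apply/bigcapP => S /andP[].
have DS i S : S \in tight f x -> i \in S -> D i \subset S.
  by move=> St iS; apply: bigcap_inf; rewrite St.
(* The inclusion [D j \subset D i] is strict: were [i] in [D j], no tight set could separate [i]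
   from [j]. *)
have Dlt i j : j \in D i -> j != i -> (#|D j| < #|D i|)%N.
  move=> jD ji; apply: proper_card; apply/properP; split; first exact: DS.
  exists i => //; apply/negP => iDj; have [S St] := sep j i ji.
  case: (boolP (j \in S)) => jS; case: (boolP (i \in S)) => iS //= _.
    by rewrite (subsetP (DS j S St jS) i iDj) in iS.
  by rewrite (subsetP (DS i S St iS) j jD) in jS.
(* Order by the size of [D i], with ties broken by the index. Initial segments are then unions of
   sets [D i], hence tight. *)
pose r (i : 'I_n) := (#|D i| * n + i)%N.
have rI : injective r.
  move=> i j rij; apply: val_inj => /=; have := congr1 (modn^~ n) rij.
  by rewrite /r !modnMDl !modn_small.
have pre (p : pred nat) : (forall a b, p a -> (b <= a)%N -> p b) ->
    vsum x [set j | p (r j)] = f [set j | p (r j)].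
  move=> pd; suff : [set j | p (r j)] \in tight f x by rewrite inE => /eqP.
  have -> : [set j | p (r j)] = \bigcup_(i | p (r i)) D i.
    apply/setP => j; rewrite inE; apply/idP/bigcupP => [pj|[i pi jD]].
      by exists j.
    have [->//|ji] := eqVneq j i; apply: pd pi _.
    have := Dlt i j jD ji; rewrite /r; have := ltn_ord j; nia.
  elim/big_ind: _ => [//|A B At Bt|//].
  by have [] := tightUI fs xf At Bt.
exists r => //; apply/rowP => i; rewrite mxE.
rewrite -(pre (fun a => a <= r i)%N); last by move=> a b; lia.
rewrite -(pre (fun a => a < r i)%N); last by move=> a b; lia.
rewrite (@vsumD1 _ [set j | (r j <= r i)%N] i) ?inE //.
rewrite (_ : _ :\ i = [set j | (r j < r i)%N]) ?addrK //.
by apply/setP => j; rewrite !inE ltn_neqAle (inj_eq rI).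
Qed.

(** The predicate [K] stands for any convex set containing the greedy vectors. Induct on the number
    of sets that are not tight: if no tight set separates some [i] and [j], then [x] lies between
    two shifts along that direction, both with more tight sets; otherwise [x] is greedy. *)
Lemma base_polytope_sub_convex f (K : 'rV[R]_n -> Prop) :
  submodular f -> f set0 = 0 ->
  (forall x y t, 0 <= t <= 1 -> K x -> K y -> K (t *: x + (1 - t) *: y)) ->
  (forall r, injective r -> K (greedy f r)) ->
  forall x, base_polytope f x -> K x.
Proof.
move=> fs f0 Kc Kg x; have [m] := ubnP #|~: tight f x|.
elim: m x => // m IHm x cx xf.
case: (boolP [exists i, exists j, (i != j) && [forall S in tight f x, (i \in S) == (j \in S)]]);
  last first.
  move=> nsep; have [|r rI ->] := tight_separated_greedy fs f0 xf; last exact: Kg.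
  move=> i j ij; have := existsPn nsep i => /existsPn/(_ j).
  by rewrite ij => /forall_inPn[S St ne]; exists S.
case/existsP=> i /existsP[j /andP[ij /forall_inP same]].
have dec y : tight f x \proper tight f y -> (#|~: tight f y| < m)%N.
  move=> /proper_card; have := cardsC (tight f x); have := cardsC (tight f y); lia.
have [|t t0 [yf /dec ty]] := tight_shift ij xf; first by move=> S /same/eqP.
have [||u u0 [zf /dec tz]] := @tight_shift f x j i _ xf; first by rewrite eq_sym.
  by move=> S /same/eqP.
have tu : 0 < t + u by lra.
(* The weights are chosen so that the two opposite shifts cancel. *)
have -> : x = (u / (t + u)) *: (x + t *: (delta_mx 0 i - delta_mx 0 j)) +
              (1 - u / (t + u)) *: (x + u *: (delta_mx 0 j - delta_mx 0 i)).
  by apply/rowP => l; rewrite !mxE; field; lra.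
apply: Kc; [|exact: IHm|exact: IHm].
apply/andP; split; first by rewrite divr_ge0 ?ltW.
by rewrite ler_pdivrMr // mul1r lerDr ltW.
Qed.

(** One inclusion adds up the inequalities. For the other, the Minkowski sum is convex, and a greedy
    vector of the sum decomposes by using the same order in every summand. *)
Lemma minkowski_base_polytope (T : finType) (C : {set T}) (c : T -> R)
    (f : T -> {set 'I_n} -> R) :
  (forall I, I \in C -> 0 <= c I) -> (forall I, submodular (f I)) ->
  (forall I, f I set0 = 0) ->
  minkowski_sum C c (fun I => base_polytope (f I)) =
  base_polytope (fun S => \sum_(I in C) c I * f I S).
Proof.
move=> c0 fs f0; apply/seteqP; split=> x.
  move=> [y [yf ->]].
  have E S : vsum (\sum_(I in C) c I *: y I) S = \sum_(I in C) c I * vsum (y I) S.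
    rewrite /vsum; under [RHS]eq_bigr do rewrite mulr_sumr.
    rewrite exchange_big; apply: eq_bigr => i _; rewrite summxE.
    by apply: eq_bigr => I _; rewrite mxE.
  apply/base_polytopeP; split=> [S|]; rewrite E.
    apply: ler_sum => I IC; apply: ler_wpM2l; first exact: c0.
    by case/base_polytopeP: (yf I IC).
  by apply: eq_bigr => I IC; case/base_polytopeP: (yf I IC) => _ ->.
apply: base_polytope_sub_convex.
- move=> A B; rewrite -!big_split; apply: ler_sum => I IC.
  by rewrite /= -!mulrDr; apply: ler_wpM2l; [apply: c0|apply: fs].
- by rewrite big1 // => I _; rewrite f0 mulr0.
- move=> {}x y t t01 [x' [xf ->]] [y' [yf ->]].
  exists (fun I => t *: x' I + (1 - t) *: y' I); split.
    by move=> I IC; apply: base_polytope_convex; [|apply: xf|apply: yf].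
  rewrite !scaler_sumr -big_split; apply: eq_bigr => I _.
  by rewrite /= scalerDr !scalerA [t * _]mulrC [(1 - t) * _]mulrC.
move=> r rI; exists (fun I => greedy (f I) r); split.
  by move=> I _; apply: greedy_base.
apply/rowP => i; rewrite summxE mxE -sumrB; apply: eq_bigr => I _.
by rewrite !mxE mulrBr.
Qed.

End BasePolytope.

(** * The tropical relation for positive combinations of rank functions *)

Section WeightedRankSum.
Variables (R : realType) (n : nat) (C : {set {set 'I_n}}) (c : {set 'I_n} -> R).
Hypothesis c_gt0 : forall I : {set 'I_n}, I \in C -> 0 < c I.

Definition rank_sum (S : {set 'I_n}) : R :=
  \sum_(I in C) c I * (schubert_rank I S)%:R.

Lemma schubert_rank_submodular (I : {set 'I_n}) :
  submodular (fun S => (schubert_rank I S)%:R : R).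
Proof. by move=> A B; rewrite -!natrD ler_nat rank_submod. Qed.

Lemma rank_sum_submodular : submodular rank_sum.
Proof.
move=> A B; rewrite -!big_split; apply: ler_sum => I IC /=.
rewrite -!mulrDr; apply: ler_wpM2l; first by rewrite ltW ?c_gt0.
exact: schubert_rank_submodular.
Qed.

Lemma rank_sum0 : rank_sum set0 = 0.
Proof. by rewrite /rank_sum big1 // => I _; rewrite rank_set0 mulr0. Qed.

Lemma rank_sumD (A B : {set 'I_n}) :
  rank_sum A + rank_sum B =
  \sum_(I in C) c I * (schubert_rank I A + schubert_rank I B)%:R.
Proof.
by rewrite -big_split; apply: eq_bigr => I _; rewrite /= -mulrDr natrD.
Qed.

(** The relation asks a weighted sum of maxima to equal the maximum of the two weighted sums. With
    positive weights this holds exactly when one term is maximal in every summand at once. *)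
Lemma rank_sum_DCTP : DCTP rank_sum <-> weakly_separated_set C.
Proof.
have le_sum (p q : {set 'I_n} -> nat) : (forall I, I \in C -> (p I <= q I)%N) ->
    \sum_(I in C) c I * (p I)%:R <= \sum_(I in C) c I * (q I)%:R.
  by move=> pq; apply: ler_sum => I IC; rewrite ler_wpM2l ?ler_nat ?pq ?ltW ?c_gt0.
split=> [[_ tp] U V UC VC|ws].
  suff ncross I J : I \in C -> J \in C -> ~ crosses I J.
    by apply: not_cross_weakly_separated; apply: ncross.
  move=> IC JC /cross_preferences[X [i [j [k [[ij jk iX jX kX] BA AB]]]]].
  have := tp i j k X ij jk iX jX kX; rewrite !rank_sumD.
  have lt_sum (p q : {set 'I_n} -> nat) L : L \in C -> (p L < q L)%N ->
      (forall I, (p I <= q I)%N) ->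
      \sum_(I in C) c I * (p I)%:R < \sum_(I in C) c I * (q I)%:R.
    move=> LC pqL pq; rewrite (bigD1 L) // [ltRHS](bigD1 L) //= ltr_leD //.
      by rewrite ltr_pM2l ?c_gt0 // ltr_nat.
    by apply: ler_sum => K /andP[KC _]; rewrite ler_wpM2l ?ler_nat ?ltW ?c_gt0.
  have maxP L := rankP_max L ij jk iX jX kX.
  have ltA : \sum_(I in C) c I * (rankA I X i j k)%:R <
             \sum_(I in C) c I * (rankP I X i j k)%:R.
    by apply: (lt_sum _ _ J) => // [|L]; rewrite maxP ?leq_maxl // leq_max AB orbT.
  have ltB : \sum_(I in C) c I * (rankB I X i j k)%:R <
             \sum_(I in C) c I * (rankP I X i j k)%:R.
    by apply: (lt_sum _ _ I) => // [|L]; rewrite maxP ?leq_maxr // leq_max BA.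
  move=> PE; move: ltA ltB; rewrite /rankA /rankB /rankP PE.
  by rewrite !lt_max !ltxx /= orbF => /lt_trans h /h; rewrite ltxx.
split=> [|i j k X ij jk iX jX kX]; first exact: rank_sum_submodular.
rewrite !rank_sumD.
have maxP L := rankP_max L ij jk iX jX kX; rewrite /rankP in maxP.
(* Either the second term is maximal for every member of [C], or some [J] strictly prefers the
   first, and then absence of crossings makes the first maximal for all. *)
have [/forall_inP AB|] := boolP [forall I in C, rankA I X i j k <= rankB I X i j k]%N.
  rewrite max_r; last exact: le_sum.
  by apply: eq_bigr => I IC; rewrite maxP (maxn_idPr (AB I IC)).
move=> /forall_inPn[J JC]; rewrite -ltnNge => BAJ.
have BA I : I \in C -> (rankB I X i j k <= rankA I X i j k)%N.
  move=> IC; rewrite leqNgt; apply/negP => ABI.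
  by have := weakly_separated_cross (ws J I JC IC); apply; apply: preferences_cross BAJ ABI.
rewrite max_l; last exact: le_sum.
by apply: eq_bigr => I IC; rewrite maxP (maxn_idPl (BA I IC)).
Qed.

End WeightedRankSum.

Theorem theorem1p2 (R : realType) (n : nat) (C : {set {set 'I_n}})
    (c : {set 'I_n} -> R) (c_gt0 : forall I : {set 'I_n}, I \in C -> 0 < c I) :
  MV_polytope (minkowski_sum C c (@schubert_polytope R n)) <->
  weakly_separated_set C.
Proof.
have QE : minkowski_sum C c (@schubert_polytope R n) = base_polytope (rank_sum C c).
  apply: minkowski_base_polytope => [I IC|I|I]; first by rewrite ltW ?c_gt0.
    exact: schubert_rank_submodular.
  by rewrite rank_set0.
have ->: weakly_separated_set C <-> DCTP (rank_sum C c).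
  by split=> /(rank_sum_DCTP c_gt0).
rewrite QE; split=> [[f [fD f0 Qf]]|FD]; last by exists (rank_sum C c); rewrite rank_sum0.
(* Any DCTP function vanishing at the empty set that represents the polytope must be [rank_sum]
   itself, so its tropical relation transfers. *)
have Ff : rank_sum C c =1 f.
  by apply: base_polytope_inj Qf => //; [apply: rank_sum_submodular|apply: rank_sum0|case: fD].
case: fD => fs ft; split=> [|i j k X ij jk iX jX kX]; first exact: rank_sum_submodular.
by rewrite !Ff; apply: ft.
Qed.
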